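(* Let $\mathbf{k}$ be an algebraically closed field of characteristic $0$, let $P$ be a basic symmetric indecomposable finite-dimensional associative $\mathbf{k}$-algebra, let $1=e_1+\cdots+e_k$ be a decomposition of the unity into mutually orthogonal primitive idempotents, and let $\phi$ be a symmetric linear function on $P$ such that $\langle a,b\rangle=\phi(ab)$ is a nondegenerate bilinear form on $P$ and $\phi(e_i)=0$ for all $1\le i\le k$. Let $f_1,\dots,f_k$ and $\Omega$ be as in the context. Let $W$ be a finitely generated right $P$-module. Then $W$ is interlocked with $\phi$ if and only if $W$ is projective. In particular, if $W$ is interlocked with $\phi$, then for each $1\le i\le k$ the multiplicity of the indecomposable projective module $e_iP$ in $W$ is $\dim_{\mathbf{k}} Wf_i$.
   Context: A linear function $\phi:P\to\mathbf{k}$ is symmetric if $\phi(ab)=\phi(ba)$ for all $a,b\in P$. $J(P)$ is the Jacobson radical. Since $P$ is basic, $P/J(P)=\mathbf{k}\bar e_1\oplus\cdots\oplus\mathbf{k}\bar e_k$, and $\{e_iP\}_{i=1}^k$ is the complete list of indecomposable projective right $P$-modules. The left and right socles of $P$ coincide and form a two-sided ideal $\mathrm{Soc}(P)=J(P)^{\perp}$ (orthogonal with respect to $\langle a,b\rangle=\phi(ab)$), so $\langle\ ,\ \rangle$ induces a nondegenerate pairing $\mathrm{Soc}(P)\times P/J(P)\to\mathbf{k}$; $\{f_1,\dots,f_k\}$ denotes the basis of $\mathrm{Soc}(P)$ dual to $\{\bar e_1,\dots,\bar e_k\}$, i.e. $\langle f_i,e_j\rangle=\delta_{ij}$. Put $d_{ij}=\dim_{\mathbf{k}}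 e_iJ(P)e_j/e_i\mathrm{Soc}(P)e_j$ (one has $d_{ij}=d_{ji}$). Fix a basis $\Omega=\{\rho_0^{ii},\rho_{d_{ii}+1}^{ii},\rho_{s}^{ij}\mid 1\le i,j\le k,\ 1\le s\le d_{ij}\}$ of $P$ satisfying: (a) $\rho_0^{ii}=e_i$ and $\rho_{d_{ii}+1}^{ii}=f_i$; (b) $e_i\rho_s^{ij}e_j=\rho_s^{ij}$; (c) $\langle\rho_s^{ij},\rho_{d_{ab}+1-t}^{ab}\rangle=\delta_{i,b}\delta_{j,a}\delta_{s,t}$; (d) $\rho_s^{ij}\rho_{d_{ji}+1-s}^{ji}=f_i$; (e) the span of $\{\rho_t^{ij}\mid t\ge s\}$ is $e_iPe_i$-invariant. (Such a basis is provided by a lemma of Miyamoto. The set $\Omega-\{e_1,\dots,e_k\}$ is a basis of $J(P)$.) A finitely generated right $P$-module $W$ is interlocked with $\phi$ if for every $1\le i\le k$, $\ker(f_i):=\{w\in W\mid wf_i=0\}$ equals $\sum_{\rho\in\Omega-\{e_i\}}W\rho$. *)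

(* Defs.v *)
From HB Require Import structures.
From mathcomp Require Import all_boot all_order all_algebra all_field.

Set Implicit Arguments.
Unset Strict Implicit.
Unset Printing Implicit Defensive.

Import GRing.Theory.
Local Open Scope ring_scope.

(* A right P-module is a left module over the converse ring P^c: the scalar   *)
(* multiplication satisfies a *: (b *: w) = (b * a) *: w for a, b : P.        *)
Notation rmodType P := (lmodType (P : nzRingType)^c).

Definition ract (P : nzRingType) (W : rmodType P) (w : W) (a : P) : W :=
  (a : P^c) *: w.

Section Modules.
Variable R : nzRingType.

Definition finitely_generated (W : lmodType R) : Prop :=
  exists (m : nat) (g : 'I_m -> W),
    forall w, exists a : 'I_m -> R, w = \sum_(j < m) a j *: g j.

Definition projective (W : lmodType R) : Prop :=
  forall (M N : lmodType R) (g : {linear M -> N}) (h : {linear W -> N}),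
    (forall y, exists x, g x = y) ->
    exists h' : {linear W -> M}, forall w, g (h' w) = h w.

Definition isomorphic (M N : lmodType R) : Prop :=
  exists f : {linear M -> N}, bijective f.

Definition zero_module (M : lmodType R) : Prop := forall x : M, x = 0.

Definition indecomposable_module (M : lmodType R) : Prop :=
  ~ zero_module M /\
  forall A B : lmodType R,
    isomorphic M (A * B)%type -> zero_module A \/ zero_module B.

Definition direct_sum (W : lmodType R) (r : nat) (U : 'I_r -> lmodType R)
    (iota : forall j, {linear U j -> W}) : Prop :=
  (forall w, exists u : forall j, U j, w = \sum_(j < r) iota j (u j)) /\
  (forall u : forall j, U j,
     \sum_(j < r) iota j (u j) = 0 -> forall j, u j = 0).

Definition krull_schmidt_decomposition (W : lmodType R) (r : nat)
    (U : 'I_r -> lmodType R) : Prop :=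
  (forall j, indecomposable_module (U j)) /\
  exists iota : forall j, {linear U j -> W}, direct_sum iota.

(* W has a finite decomposition into indecomposables, and in every such       *)
(* decomposition exactly m summands are isomorphic to M.                      *)
Definition multiplicity (M W : lmodType R) (m : nat) : Prop :=
  (exists (r : nat) (U : 'I_r -> lmodType R),
     krull_schmidt_decomposition W U) /\
  (forall (r : nat) (U : 'I_r -> lmodType R),
     krull_schmidt_decomposition W U ->
     exists A : {set 'I_r},
       (forall j, j \in A <-> isomorphic M (U j)) /\ #|A| = m).

End Modules.

Section PrincipalModule.
Variables (K : fieldType) (P : falgType K).

Record principal (e : P) := Principal {
  principal_val : (P^c)^o;
  _ : (principal_val : P) \in limg (amull e)
}.

Variable e : P.

Definition principal_pred : {pred (P^c)^o} :=
  fun x => (x : P) \in limg (amull e).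

HB.instance Definition _ := [isSub for @principal_val e].
HB.instance Definition _ := [Choice of principal e by <:].

Fact principal_submod_closed : submod_closed principal_pred.
Proof.
split=> [|a x y]; rewrite !unfold_in; first exact: mem0v.
move=> /memv_imgP[u _ ->] /memv_imgP[v _ ->].
apply/memv_imgP; exists (u * (a : P) + v); first exact: memvf.
by rewrite !lfunE /= mulrDr mulrA.
Qed.

HB.instance Definition _ :=
  GRing.isSubmodClosed.Build P^c (P^c)^o principal_pred principal_submod_closed.
HB.instance Definition _ :=
  GRing.SubChoice_isSubLmodule.Build P^c (P^c)^o principal_pred (principal e)
    principal_submod_closed.

End PrincipalModule.

Section Algebras.
Variables (K : fieldType) (P : falgType K).

(* One-sided ideals of the ring P are automatically K-subspaces, K being      *)
(* embedded in P through c |-> c%:A.                                          *)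
Definition right_ideal (I : {vspace P}) : Prop := (I * fullv <= I)%VS.

Definition two_sided_ideal (I : {vspace P}) : Prop :=
  (fullv * I <= I)%VS /\ (I * fullv <= I)%VS.

Definition maximal_right_ideal (M : {vspace P}) : Prop :=
  [/\ right_ideal M, M <> fullv &
      forall N, right_ideal N -> (M <= N)%VS -> N = M \/ N = fullv].

Definition minimal_right_ideal (M : {vspace P}) : Prop :=
  [/\ right_ideal M, M <> 0%VS &
      forall N, right_ideal N -> (N <= M)%VS -> N = 0%VS \/ N = M].

(* The intersection of all maximal right ideals.                              *)
Definition is_jacobson_radical (J : {vspace P}) : Prop :=
  forall x, x \in J <-> (forall M, maximal_right_ideal M -> x \in M).

(* The sum of all minimal right ideals, i.e. the right socle.                 *)
Definition is_socle (S : {vspace P}) : Prop :=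
  (forall M, minimal_right_ideal M -> (M <= S)%VS) /\
  (forall T : {vspace P},
     (forall M, minimal_right_ideal M -> (M <= T)%VS) -> (S <= T)%VS).

Definition indecomposable_algebra : Prop :=
  forall I1 I2 : {vspace P}, two_sided_ideal I1 -> two_sided_ideal I2 ->
    (I1 + I2)%VS = fullv -> (I1 :&: I2)%VS = 0%VS -> I1 = 0%VS \/ I2 = 0%VS.

Definition symmetric_function (phi : {scalar P}) : Prop :=
  forall a b, phi (a * b) = phi (b * a).

(* For symmetric phi, left and right nondegeneracy are the same condition.    *)
Definition nondegenerate_form (phi : {scalar P}) : Prop :=
  forall a, (forall b, phi (a * b) = 0) -> a = 0.

Definition symmetric_algebra : Prop :=
  exists phi : {scalar P}, symmetric_function phi /\ nondegenerate_form phi.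

Definition primitive_idempotent (e : P) : Prop :=
  [/\ e * e = e, e <> 0 &
      forall a b, a * a = a -> b * b = b -> a * b = 0 -> b * a = 0 ->
        e = a + b -> a = 0 \/ b = 0].

Definition complete_primitive_idempotents (n : nat) (e : 'I_n -> P) : Prop :=
  [/\ forall i, primitive_idempotent (e i),
      forall i j, i != j -> e i * e j = 0 &
      \sum_(i < n) e i = 1].

(* Given a complete set e of orthogonal primitive idempotents of P.           *)
Definition basic_algebra (n : nat) (e : 'I_n -> P) : Prop :=
  forall i j,
    isomorphic (principal (e i) : rmodType P) (principal (e j)) -> i = j.

Definition dual_socle_basis (phi : {scalar P}) (S : {vspace P}) (n : nat)
    (e f : 'I_n -> P) : Prop :=
  basis_of S [seq f i | i <- enum 'I_n] /\
  (forall i j, phi (f i * e j) = (i == j)%:R).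

Section MiyamotoBasis.
Variables (phi : {scalar P}) (J S : {vspace P}) (n : nat).
Variables (e f : 'I_n -> P).

(* U :\: V is a complement of U :&: V in U, so its dimension is that of U/V.  *)
Definition peirce_dim (i j : 'I_n) : nat :=
  \dim ((<[e i]> * J * <[e j]>) :\: (<[e i]> * S * <[e j]>))%VS.

(* The values of s for which rho_s^{ij} is an element of the basis.           *)
Definition basis_range (i j : 'I_n) : seq nat :=
  if i == j then iota 0 (peirce_dim i j).+2 else iota 1 (peirce_dim i j).

Variable rho : 'I_n -> 'I_n -> nat -> P.

Definition Omega : seq P :=
  [seq rho ij.1 ij.2 s |
     ij <- enum {: 'I_n * 'I_n}, s <- basis_range ij.1 ij.2].

Record miyamoto_basis : Prop := MiyamotoBasis {
  miyamoto_basis_of : basis_of fullv Omega;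
  miyamoto_a : forall i,
    rho i i 0 = e i /\ rho i i (peirce_dim i i).+1 = f i;
  miyamoto_b : forall i j s, s \in basis_range i j ->
    e i * rho i j s * e j = rho i j s;
  miyamoto_c : forall i j s a b t,
    s \in basis_range i j -> t \in basis_range a b ->
    phi (rho i j s * rho a b ((peirce_dim a b).+1 - t)%N)
      = ((i == b) && (j == a) && (s == t))%:R;
  miyamoto_d : forall i j s, s \in basis_range i j ->
    rho i j s * rho j i ((peirce_dim j i).+1 - s)%N = f i;
  miyamoto_e : forall i j s,
    let U := <<[seq rho i j t | t <- basis_range i j & (s <= t)%N]>>%VS in
    (<[e i]> * fullv * <[e i]> * U <= U)%VS
}.

End MiyamotoBasis.

Section RightModules.
Variable W : rmodType P.

Definition interlocked (n : nat) (e f : 'I_n -> P) (Om : seq P) : Prop :=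
  forall i (w : W),
    ract w (f i) = 0 <->
    exists c : P -> W, w = \sum_(x <- Om | x != e i) ract (c x) x.

(* The subset X of W is a K-subspace of dimension m, where K acts on W        *)
(* through P.                                                                 *)
Definition has_dim (X : W -> Prop) (m : nat) : Prop :=
  exists b : 'I_m -> W,
    (forall x, X x <-> exists c : 'I_m -> K,
                         x = \sum_(l < m) ract (b l) (c l)%:A) /\
    (forall c : 'I_m -> K,
       \sum_(l < m) ract (b l) (c l)%:A = 0 -> forall l, c l = 0).

Definition ract_image (a : P) (x : W) : Prop := exists w, x = ract w a.

End RightModules.

End Algebras.

(* Main.v *)
(* The socle vectors give characters chi_i(b) = phi(f_i b) with
   b f_i = f_i b = chi_i(b) f_i, and Omega - {e_i} spans the kernel of chi_i.
   Hence ker(f_i) = sum W rho holds for free modules, and it passes to direct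
   summands. Conversely, every nonzero right ideal meets the socle, so if all
   chi_i vanish at y then left multiplication by 1 - y is injective and 1 - y is
   invertible, which replaces Nakayama's lemma. In an interlocked W, a minimal
   family of generators w_t = w_t e_(a t) is then free: a nontrivial relation
   could be pushed into the socle and would make some w_t redundant. So W is the
   direct sum of the e_(a t)P, and dim W f_i counts the t with a t = i, which
   also gives the multiplicities because every indecomposable summand of W is
   again interlocked. *)
Require Import Defs.
From HB Require Import structures.
From Stdlib Require Import ClassicalEpsilon.
From mathcomp Require Import all_boot all_order all_algebra all_field.
Set Implicit Arguments.
Unset Strict Implicit.
Unset Printing Implicit Defensive.

Import GRing.Theory.
Local Open Scope ring_scope.

(** * Right ideals and the socle *)

Section RightIdeals.
Variables (K : fieldType) (P : falgType K).

Lemma right_ideal_mull (x : P) : right_ideal (limg (amull x)).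
Proof.
apply/prodvP=> _ v /memv_imgP[u _ ->] _; apply/memv_imgP.
by exists (u * v); rewrite ?memvf // !lfunE /= mulrA.
Qed.

Lemma exists_minimal_right_ideal (I : {vspace P}) :
  right_ideal I -> I <> 0%VS ->
  exists2 M, minimal_right_ideal M & (M <= I)%VS.
Proof.
have [d] := ubnP (\dim I); elim: d I => // d IHd I leId rI nzI.
case: (classic (exists N,
  [/\ right_ideal N, (N <= I)%VS, N <> 0%VS & N <> I])) => [|noN].
  case=> N [rN sNI nzN neqNI].
  have ltNI: (\dim N < \dim I)%N.
    rewrite ltn_neqAle dimvS // andbT; apply/eqP=> eqd; case: neqNI.
    by apply/eqP; rewrite eqEdim sNI eqd /=.
  case: (IHd N) => //; first exact: leq_trans ltNI _.
  by move=> M minM sMN; exists M => //; apply: subv_trans sMN sNI.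
exists I => //; split=> // N rN sNI.
case: (eqVneq N 0%VS) => [|/eqP nzN]; [by left | right].
case: (eqVneq N I) => // /eqP neqNI; case: noN; by exists N.
Qed.

Variable S : {vspace P}.
Hypothesis socS : is_socle S.

(** By [is_socle], [S] is the least subspace containing all minimal right ideals; the preimage of
    [S] under right multiplication by [v] contains them too. *)
Lemma socle_right_ideal : right_ideal S.
Proof.
apply/prodvP=> u v Su _; case: socS => [minS leS].
have: (S <= amulr v @^-1: S)%VS.
  apply: leS => M minM; apply/subvP=> x Mx; rewrite -memv_preim lfunE /=.
  apply: (subvP (minS _ minM)); case: minM => /prodvP rM _ _.
  by apply: rM; rewrite ?memvf.
by move/subvP/(_ u Su); rewrite -memv_preim lfunE.
Qed.

Lemma socle_essential (x : P) :
  x != 0 -> exists2 b, x * b \in S & x * b != 0.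
Proof.
move=> nzx; have nzI : limg (amull x) <> 0%VS.
  move=> I0; have: amull x 1 \in limg (amull x) by rewrite memv_img ?memvf.
  by rewrite I0 memv0 lfunE /= mulr1 (negPf nzx).
have [M minM sMI] := exists_minimal_right_ideal (@right_ideal_mull x) nzI.
have nzM : M != 0%VS by case: minM => _ /eqP.
have /memv_imgP[b _ def_b] := subvP sMI _ (memv_pick M).
exists b; move: def_b; rewrite lfunE /= => <-; last by rewrite vpick0.
by apply: (subvP (socS.1 _ minM)); apply: memv_pick.
Qed.

(** The multiplier is built one index at a time: if x_i b is nonzero, a further factor moves it into
    [S] without killing it, and terms already in [S] stay there because [S] is a right ideal. *)
Lemma socle_essential_family (I : finType) (x : I -> P) (i0 : I) :
  x i0 != 0 -> exists2 b, forall i, x i * b \in S & exists i, x i * b != 0.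
Proof.
move=> nzx.
suffices /(_ (enum I))[b Sb nzb] : forall s : seq I,
    exists2 b, forall i, i \in s -> x i * b \in S & exists i, x i * b != 0.
  by exists b => // i; rewrite Sb ?mem_enum.
elim=> [|i s [b Sb nzb]]; first by exists 1 => //; exists i0; rewrite mulr1.
have [xib0 | nzxib] := eqVneq (x i * b) 0.
  by exists b => // j /predU1P[->|/Sb //]; rewrite xib0 mem0v.
have [c Sc nzc] := socle_essential nzxib.
exists (b * c); last by exists i; rewrite mulrA.
move=> j /predU1P[->|/Sb Sjb]; rewrite mulrA //.
exact: (prodvP socle_right_ideal) Sjb (memvf c).
Qed.

End RightIdeals.

(** * Kernels of linear maps *)

Section ModuleKernel.
Variables (R : nzRingType) (M N : lmodType R) (h : {linear M -> N}).

(** A type rather than a predicate: [indecomposable_module] speaks of products of modules, so the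
    complement of a split summand has to be an [lmodType]. *)
Record kernel := Kernel { kernel_val : M; _ : h kernel_val == 0 }.

Definition kernel_pred : {pred M} := fun x => h x == 0.

HB.instance Definition _ := [isSub for kernel_val].
HB.instance Definition _ := [Choice of kernel by <:].

Fact kernel_submod_closed : submod_closed kernel_pred.
Proof.
split=> [|a x y]; rewrite !unfold_in /= ?linear0 //.
by move=> /eqP hx0 /eqP hy0; rewrite linearP hx0 hy0 scaler0 addr0.
Qed.

HB.instance Definition _ :=
  GRing.isSubmodClosed.Build R M kernel_pred kernel_submod_closed.
HB.instance Definition _ :=
  GRing.SubChoice_isSubLmodule.Build R M kernel_pred kernel
    kernel_submod_closed.

End ModuleKernel.

(** * Split epimorphisms, direct sums and projectivity *)

Section ModuleTheory.
Variable R : nzRingType.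
Implicit Types M N W : lmodType R.

Definition to_linear M N (h : M -> N) (h_linear : linear h) :
  {linear M -> N} := HB.pack h (GRing.isLinear.Build R M N *:%R h h_linear).

Lemma isomorphic_sym M N : isomorphic M N -> isomorphic N M.
Proof.
case=> h [h' hK h'K]; exists (to_linear (can2_linear hK h'K)).
by exists h.
Qed.

Lemma isomorphic_trans M N W :
  isomorphic M N -> isomorphic N W -> isomorphic M W.
Proof. by case=> g bij_g [h bij_h]; exists (h \o g); apply: bij_comp. Qed.

Lemma split_epi_isomorphic M N (h : {linear M -> N}) (s : {linear N -> M}) :
  cancel s h -> isomorphic M (N * kernel h)%type.
Proof.
move=> sK; have ker_sub x : h (x - s (h x)) == 0.
  by rewrite linearB /= sK subrr.
pose g x : N * kernel h := (h x, Kernel (ker_sub x)).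
have g_linear : linear g.
  move=> a x y; congr (_, _); first exact: linearP.
  by apply: val_inj; rewrite /= !linearP /= scalerDr addrACA.
exists (to_linear g_linear); exists (fun y => s y.1 + val y.2) => [x|[y z]].
  by rewrite /= addrC subrK.
have hz0 : h (val z) = 0 by apply/eqP; case: z.
congr (_, _); first by rewrite /= linearD /= sK hz0 addr0.
by apply: val_inj; rewrite /= linearD /= sK hz0 addr0 addrC addKr.
Qed.

Lemma indecomposable_split_epi M N (h : {linear M -> N}) (s : {linear N -> M}) :
  cancel s h -> indecomposable_module M -> ~ zero_module N -> isomorphic N M.
Proof.
move=> sK [_ indecM] nzN.
case: (indecM _ _ (split_epi_isomorphic sK)) => // ker0.
exists s; exists h => // x; apply/esym/eqP; rewrite -subr_eq0.
have ker_sub : h (x - s (h x)) == 0 by rewrite linearB /= sK subrr.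
by have /(congr1 val)/= -> := ker0 (Kernel ker_sub).
Qed.

Section DirectSum.
Variables (W : lmodType R) (r : nat) (U : 'I_r -> lmodType R).
Variable iota : forall j, {linear U j -> W}.
Hypothesis sumW : direct_sum iota.

Lemma direct_sum_inj (u v : forall j, U j) :
  \sum_(j < r) iota j (u j) = \sum_(j < r) iota j (v j) ->
  forall j, u j = v j.
Proof.
move=> eq_uv j; apply/eqP; rewrite -subr_eq0; apply/eqP.
apply: (sumW.2 (fun j => u j - v j)).
under eq_bigr do rewrite linearB.
by rewrite sumrB; apply/eqP; rewrite subr_eq0; apply/eqP.
Qed.

Lemma direct_sum_proj : exists pi : forall j, {linear W -> U j},
  [/\ forall w, w = \sum_(j < r) iota j (pi j w),
      forall u j, pi j (\sum_(l < r) iota l (u l)) = u j &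
      forall j, cancel (iota j) (pi j)].
Proof.
(* The components of [w] are picked by choice; their uniqueness then makes them linear in [w]. *)
pose c w := proj1_sig (constructive_indefinite_description _ (sumW.1 w)).
have cE w : w = \sum_(j < r) iota j (c w j).
  by rewrite /c; case: constructive_indefinite_description.
have c_linear j : linear (fun w => c w j).
  move=> a v w.
  apply: (@direct_sum_inj _ (fun j => a *: c v j + c w j)); rewrite -cE.
  under eq_bigr do rewrite linearP.
  by rewrite big_split /= -scaler_sumr -!cE.
exists (fun j => to_linear (c_linear j)); split=> [w|u j|j x] /=.
- exact: cE.
- by apply: direct_sum_inj; rewrite -cE.
pose u := dfwith (fun l => 0 : U l) x.
rewrite -[RHS](dfwith_in (fun l => 0 : U l) x) -/u.
apply: direct_sum_inj; rewrite -cE (bigD1 j) //= /u dfwith_in big1 ?addr0 //.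
by move=> l neq; rewrite dfwith_out 1?eq_sym // linear0.
Qed.

Lemma direct_sum_projective : (forall j, projective (U j)) -> projective W.
Proof.
move=> projU M N g h g_onto; have [pi [piE _ _]] := direct_sum_proj.
have /fin_all_exists[h' h'E] j : exists h' : {linear U j -> M},
    forall x, g (h' x) = h (iota j x).
  exact: (projU j M N g (h \o iota j)).
have sum_linear : linear (fun w => \sum_(j < r) h' j (pi j w)).
  move=> a v w; rewrite scaler_sumr -big_split /=.
  by apply: eq_bigr => j _; rewrite !linearP.
exists (to_linear sum_linear) => w; rewrite /= {2}[w]piE !linear_sum.
by apply: eq_bigr => j _; rewrite h'E.
Qed.

Lemma direct_sum_isomorphic (V : 'I_r -> lmodType R)
    (theta : forall j, {linear V j -> U j}) :
  (forall j, bijective (theta j)) ->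
  direct_sum (fun j => (iota j \o theta j : {linear V j -> W})).
Proof.
move=> bij_theta; split=> [w|v /sumW.2 theta0 j].
  case: (sumW.1 w) => u ->.
  have /fin_all_exists[v vE] j : exists y, theta j y = u j.
    by case: (bij_theta j) => t _ tK; exists (t (u j)).
  by exists v; apply: eq_bigr => j _ /=; rewrite vE.
by apply: (bij_inj (bij_theta j)); rewrite theta0 linear0.
Qed.

End DirectSum.

Lemma finitely_generated_onto M N (h : {linear M -> N}) :
  (forall y, exists x, h x = y) -> finitely_generated M -> finitely_generated N.
Proof.
move=> h_onto [m [g gM]]; exists m, (h \o g) => y.
have [x <-] := h_onto y; have [a ->] := gM x; exists a.
by rewrite linear_sum; apply: eq_bigr => j _; rewrite linearZ.
Qed.

(* Lifts the identity of [W] through a surjection from a free module. *)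
Lemma projective_dual_basis W :
  finitely_generated W -> projective W ->
  exists (m : nat) (g : 'I_m -> W) (c : 'I_m -> {linear W -> R^o}),
    forall w, w = \sum_(j < m) (c j w : R) *: g j.
Proof.
case=> m [g gW] projW.
pose F : lmodType R := {ffun 'I_m -> R^o}.
pose p (a : F) := \sum_(j < m) (a j : R) *: g j.
have p_linear : linear p.
  move=> c a b; rewrite scaler_sumr -big_split /=.
  by apply: eq_bigr => j _; rewrite !ffunE scalerDl scalerA.
have p_onto w : exists a, to_linear p_linear a = w.
  have [a ->] := gW w; exists [ffun j => a j : R^o].
  by rewrite /= /p; apply: eq_bigr => j _; rewrite ffunE.
have [s sK] := projW F W (to_linear p_linear) idfun p_onto.
have c_linear j : linear (fun w => s w j : R^o).
  by move=> a v w; rewrite linearP !ffunE.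
exists m, g, (fun j => to_linear (c_linear j)) => w.
by rewrite -[LHS]sK.
Qed.

End ModuleTheory.

(** * Rules for the right action *)

Section RightAction.
Variables (P : nzRingType) (W : rmodType P).
Implicit Types (w : W) (a b : P).

Lemma ractA w a b : ract (ract w a) b = ract w (a * b).
Proof. by rewrite /ract scalerA. Qed.

Lemma ract1 w : ract w 1 = w. Proof. exact: scale1r. Qed.
Lemma ract0r w : ract w 0 = 0. Proof. exact: scale0r. Qed.
Lemma ract0l a : ract (0 : W) a = 0. Proof. exact: scaler0. Qed.

Lemma ractDr w a b : ract w (a + b) = ract w a + ract w b.
Proof. exact: scalerDl. Qed.
Lemma ractBr w a b : ract w (a - b) = ract w a - ract w b.
Proof. exact: scalerBl. Qed.

Lemma ract_sumr I (s : seq I) (C : pred I) (F : I -> P) w :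
  ract w (\sum_(i <- s | C i) F i) = \sum_(i <- s | C i) ract w (F i).
Proof. exact: scaler_suml. Qed.

Lemma ract_suml I (s : seq I) (C : pred I) (F : I -> W) a :
  ract (\sum_(i <- s | C i) F i) a = \sum_(i <- s | C i) ract (F i) a.
Proof. exact: scaler_sumr. Qed.

Lemma linear_ract (V : rmodType P) (h : {linear W -> V}) w a :
  h (ract w a) = ract (h w) a.
Proof. exact: linearZ. Qed.

End RightAction.

(** * The modules eP *)

Section PrincipalModules.
Variables (K : fieldType) (P : falgType K) (e : P).
Hypothesis idem_e : e * e = e.

Lemma principal_mem (x : P) : e * x \in limg (amull e).
Proof. by apply/memv_imgP; exists x; rewrite ?memvf // lfunE. Qed.

Definition principal_elt (x : P) : principal e :=
  @Principal K P e (e * x) (principal_mem x).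

Lemma idem_mul_principal (x : principal e) : e * principal_val x = principal_val x.
Proof.
by case: x => x /= /memv_imgP[y _ ->]; rewrite !lfunE /= mulrA idem_e.
Qed.

Lemma principal_eltK (x : principal e) : principal_elt (principal_val x : P) = x.
Proof. by apply: val_inj; apply: idem_mul_principal. Qed.

Lemma principal_map_linear (W : rmodType P) (w : W) :
  linear (fun x : principal e => ract w (principal_val x : P)).
Proof. by move=> a x y; rewrite /ract scalerDl -scalerA. Qed.

Definition principal_map (W : rmodType P) (w : W) : {linear principal e -> W} :=
  to_linear (principal_map_linear w).

(** A map out of eP is determined by the image of e. Any preimage y of h(e) gives a lift x -> y x,
    because x = e x on eP. *)
Lemma principal_projective : projective (principal e : rmodType P).
Proof.
move=> M N g h g_onto.
have [y gy] := g_onto (h (principal_elt 1)); exists (principal_map y) => x.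
rewrite /= linear_ract gy -linear_ract -[in RHS](principal_eltK x); congr (h _).
by apply: val_inj; rewrite /= mulr1.
Qed.

End PrincipalModules.

(** * Uniqueness of dimension *)

Section DimensionUniqueness.
Variables (K : fieldType) (P : falgType K) (W : rmodType P) (X : W -> Prop).

(** Writing each family in terms of the other gives matrices with A B = 1, by freeness of [b]; this
    bounds the size m of the identity by m'. *)
Lemma has_dim_leq m m' :
  has_dim (K := K) (P := P) X m -> has_dim (K := K) (P := P) X m' -> (m <= m')%N.
Proof.
case=> b [bX b_free] [b' [b'X _]].
have mem_basis k (g : 'I_k -> W) (gX : forall x, X x <->
    exists c : 'I_k -> K, x = \sum_(l < k) ract (g l) (c l)%:A) l : X (g l).
  apply/gX; exists (fun l' => (l' == l)%:R).
  rewrite (bigD1 l) //= eqxx scale1r ract1 big1 ?addr0 // => l' /negPf->.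
  by rewrite scale0r ract0r.
have /fin_all_exists[A AE] l : exists c : 'I_m' -> K,
    b l = \sum_(l' < m') ract (b' l') (c l')%:A by apply/b'X/(mem_basis _ b).
have /fin_all_exists[B BE] l' : exists c : 'I_m -> K,
    b' l' = \sum_(l < m) ract (b l) (c l)%:A by apply/bX/(mem_basis _ b').
apply: (@mulmx1_min _ _ _ (\matrix_(l, l') A l l') (\matrix_(l', l) B l' l)).
apply/matrixP=> l l2; rewrite !mxE.
suffices /(_ l2) /eqP: forall l2, \sum_l' A l l' * B l' l2 - (l == l2)%:R = 0.
  by rewrite subr_eq0 => /eqP<-; apply: eq_bigr => l' _; rewrite !mxE.
apply: b_free; under eq_bigr do rewrite scalerBl ractBr.
rewrite sumrB; apply/eqP; rewrite subr_eq0; apply/eqP.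
transitivity (b l); last first.
  rewrite (bigD1 l) //= eqxx scale1r ract1 big1 ?addr0 // => l' neq.
  by rewrite eq_sym (negPf neq) scale0r ract0r.
rewrite [RHS]AE; under [RHS]eq_bigr do rewrite BE ract_suml.
rewrite exchange_big; apply: eq_bigr => l3 _; rewrite scaler_suml ract_sumr.
by apply: eq_bigr => l' _; rewrite ractA mulr_algr scalerA.
Qed.

Lemma has_dim_unique m m' :
  has_dim (K := K) (P := P) X m -> has_dim (K := K) (P := P) X m' -> m = m'.
Proof.
move=> dim_m dim_m'; apply/eqP; rewrite eqn_leq.
by rewrite !(has_dim_leq (m := _) (m' := _)).
Qed.

End DimensionUniqueness.

(** * The characters of P on its socle *)

Section SocleCharacters.
Variables (K : fieldType) (P : falgType K) (n : nat) (e f : 'I_n -> P).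
Variables (phi : {scalar P}) (S : {vspace P}).
Hypothesis he : complete_primitive_idempotents e.
Hypothesis phiC : symmetric_function phi.
Hypothesis phi_nondeg : nondegenerate_form phi.
Hypothesis hS : is_socle S.
Hypothesis hf : dual_socle_basis phi S e f.
Hypothesis efe : forall i, e i * f i * e i = f i.

Definition socle_character (i : 'I_n) (b : P) : K := phi (f i * b).
Local Notation chi := socle_character.

Lemma mul_idem i j : e i * e j = (i == j)%:R *: e i.
Proof.
have [<-|neq] := eqVneq i j; first by case: he => /(_ i)[-> _ _]; rewrite scale1r.
by case: he => _ -> //; rewrite scale0r.
Qed.

Lemma idemK i : e i * e i = e i. Proof. by rewrite mul_idem eqxx scale1r. Qed.

Lemma sum_idem : \sum_i e i = 1. Proof. by case: he. Qed.

Lemma chi_is_linear i : linear_for *%R (chi i).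
Proof. by move=> c u v; rewrite /chi mulrDr -scalerAr linearP. Qed.
HB.instance Definition _ i :=
  GRing.isLinear.Build K P K *%R (chi i) (chi_is_linear i).

Lemma chi_idem i j : chi i (e j) = (i == j)%:R.
Proof. by case: hf => _; apply. Qed.

Lemma idem_mul_socle i j : e i * f j = (i == j)%:R *: f j.
Proof.
rewrite -(efe j) !mulrA mul_idem; have [->|] := eqVneq i j.
  by rewrite !scale1r.
by rewrite !scale0r !mul0r.
Qed.

Lemma mem_socle i : f i \in S.
Proof. by apply: (basis_mem hf.1); rewrite map_f ?mem_enum. Qed.

Lemma socle_expand y : y \in S -> y = \sum_i phi (y * e i) *: f i.
Proof.
case: hf => bS phi_fe; rewrite -{1}(span_basis bS).
case/(free_span (basis_free bS))=> k def_y _.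
have {}def_y : y = \sum_i k (f i) *: f i by rewrite {1}def_y big_map big_enum.
rewrite [LHS]def_y; apply: eq_bigr => i _; congr (_ *: _).
rewrite def_y mulr_suml linear_sum (bigD1 i) //= big1 => [|j neq].
  by rewrite addr0 -scalerAl linearZ /= phi_fe eqxx mulr1.
by rewrite -scalerAl linearZ /= phi_fe (negPf neq) mulr0.
Qed.

Lemma idem_mul_mem_socle i y : y \in S -> e i * y = phi (y * e i) *: f i.
Proof.
move/socle_expand=> def_y; rewrite {1}def_y mulr_sumr (bigD1 i) //= big1.
  by rewrite addr0 -scalerAr idem_mul_socle eqxx scale1r.
by move=> j neq; rewrite -scalerAr idem_mul_socle eq_sym (negPf neq) scale0r scaler0.
Qed.

(** The product lies in the right ideal [S] and is fixed by left multiplication by e_i, which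
    projects [S] onto the line of f_i. Symmetry of [phi] identifies the coefficient. *)
Lemma socle_mul i b : f i * b = chi i b *: f i.
Proof.
have Sfb : f i * b \in S.
  by apply: (prodvP (socle_right_ideal hS)); rewrite ?mem_socle ?memvf.
have := idem_mul_mem_socle i Sfb.
by rewrite mulrA idem_mul_socle eqxx scale1r phiC mulrA idem_mul_socle eqxx scale1r.
Qed.

Lemma chi1 i : chi i 1 = 1.
Proof.
rewrite -sum_idem linear_sum (bigD1 i) //= chi_idem eqxx big1 ?addr0 //.
by move=> j neq; rewrite chi_idem eq_sym (negPf neq).
Qed.

Lemma chiM i a b : chi i (a * b) = chi i a * chi i b.
Proof. by rewrite {1}/chi mulrA socle_mul -scalerAl linearZ. Qed.

(** The left-hand version follows from nondegeneracy: pairing the difference of the two sides with c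
    gives chi_i(c b) - chi_i(b) chi_i(c) = 0. *)
Lemma mul_socle i b : b * f i = chi i b *: f i.
Proof.
apply/eqP; rewrite -subr_eq0; apply/eqP; apply: phi_nondeg => c.
rewrite mulrBl linearB /= -mulrA phiC -mulrA -/(chi i (c * b)) chiM.
by rewrite -scalerAl linearZ /= -/(chi i c) mulrC subrr.
Qed.

Lemma socle_neq0 i : f i != 0.
Proof.
apply/eqP=> fi0; have := chi1 i; rewrite /chi fi0 mul0r linear0.
by move/esym/eqP; rewrite oner_eq0.
Qed.

(* [y] kills the socle on the left, so the right ideal [{x | c x = y x}] meets
   the socle trivially and therefore vanishes. *)
Lemma scalar_sub_right_inverse (c : K) (y : P) :
  c != 0 -> (forall i, chi i y = 0) -> exists z, (c%:A - y) * z = 1.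
Proof.
move=> nzc y0; set a := _ - y.
suffices ker0 : lker (amull a) == 0%VS.
  (* In finite dimension an injective left multiplication is onto, and a preimage of 1 is the wanted
     inverse. *)
  have := memvf (1 : P); rewrite -(lker0_limgf ker0) => /memv_imgP[z _].
  by rewrite lfunE => az1; exists z.
rewrite -subv0; apply/subvP=> x xker.
rewrite memv0; apply/idPn => nzx; have [b Sxb] := socle_essential hS nzx.
case/eqP; set s := x * b in Sxb *.
have ys : y * s = 0.
  rewrite (socle_expand Sxb) mulr_sumr big1 // => i _.
  by rewrite -scalerAr mul_socle y0 scale0r scaler0.
have: a * s = 0.
  by move: xker; rewrite memv_ker lfunE /= mulrA => /eqP->; rewrite mul0r.
rewrite mulrBl ys subr0 mulr_algl => /eqP.
by rewrite scaler_eq0 (negPf nzc) => /eqP.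
Qed.

Lemma principal_socle i (x : principal (e i)) :
  (principal_val x : P) \in S -> exists c, principal_val x = c *: f i.
Proof.
by move=> Sx; eexists; rewrite -(idem_mul_principal (idemK i)) idem_mul_mem_socle.
Qed.

(** * Interlocked modules, for a basis on which chi_i detects only e_i *)

Section Interlocked.
Variables (Om : seq P) (Om_basis : basis_of fullv Om).
Hypothesis Om_chi : forall i x, x \in Om -> chi i x = (x == e i)%:R.

(** By [Om_chi], applying chi_i to an expansion in [Om] reads off the coefficient of e_i. *)
Lemma expand_ker_chi i b :
  chi i b = 0 -> exists c : P -> K, b = \sum_(x <- Om | x != e i) c x *: x.
Proof.
move=> chib0; have: b \in <<Om>>%VS by rewrite (span_basis Om_basis) memvf.
case/(free_span (basis_free Om_basis))=> c def_b _; exists c.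
rewrite {1}def_b (bigID (fun x => x == e i)) /= [X in X + _ = _]big1_seq ?add0r //.
move=> x /andP[/eqP-> Om_ei]; move: chib0.
rewrite def_b linear_sum (bigD1_seq (e i)) ?(free_uniq (basis_free Om_basis)) //=.
rewrite linearZ /= chi_idem eqxx mulr1 big1_seq ?addr0 => [->|].
  exact: scale0r.
by move=> y /andP[neq Om_y]; rewrite linearZ /= Om_chi // (negPf neq) mulr0.
Qed.

Section SpanOfGenerators.
Variables (W : rmodType P) (T : finType) (v : T -> W) (a : T -> 'I_n).

Definition spans (A : {set T}) : Prop :=
  forall w, exists p : T -> P, w = \sum_(t in A) ract (v t) (p t).

Hypothesis ker_socle : forall i (w : W), ract w (f i) = 0 ->
  exists c : P -> W, w = \sum_(x <- Om | x != e i) ract (c x) x.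
Hypothesis v_idem : forall t, ract (v t) (e (a t)) = v t.

(* A nontrivial relation can be multiplied into the socle, where it reads
   [sum_t c_t v_t f_(a t) = 0] with some [c_t1] nonzero. Restricted to the [t]
   with [a t = a t1], interlocking lifts it to [sum_t c_t v_t = sum_t v_t y_t]
   with all characters vanishing on the [y_t], so that the coefficient
   [c_t1 - y_t1] of [v_t1] is right invertible. *)
Lemma spans_exchange (A : {set T}) (p : T -> P) (t0 : T) :
  spans A -> \sum_(t in A) ract (v t) (p t) = 0 ->
  t0 \in A -> e (a t0) * p t0 != 0 ->
  exists2 t1, t1 \in A & spans (A :\ t1).
Proof.
move=> spanA rel0 At0 nzt0.
(* The value 0 outside [A] forces the index with nonzero product, found below, to lie in [A]. *)
pose x t := if t \in A then e (a t) * p t else 0.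
have [|b Sxb [t1 nzt1]] := socle_essential_family hS (x := x) (i0 := t0).
  by rewrite /x At0.
have At1 : t1 \in A by apply: contraR nzt1 => /negPf nA; rewrite /x nA mul0r.
pose c t := phi (x t * b * e (a t)).
have xbE t : x t * b = c t *: f (a t).
  rewrite /c -idem_mul_mem_socle // mulrA /x.
  by case: ifP => _; rewrite ?mulr0 // !mulrA idemK.
have nzc : c t1 != 0.
  by apply: contraNneq nzt1 => c0; rewrite xbE c0 scale0r.
have relc : \sum_(t in A) ract (v t) (c t *: f (a t)) = 0.
  rewrite -[RHS](ract0l W b) -[X in ract X b]rel0 ract_suml; apply: eq_bigr => t At.
  by rewrite -xbE /x At -!ractA v_idem.
exists t1 => //; set i := a t1.
(* Multiplying the socle relation by e_i on the right keeps only the terms with a t = i, which says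
   that u f_i = 0. *)
pose u := \sum_(t in A) ract (v t) ((a t == i)%:R * (c t)%:A).
have uf0 : ract u (f i) = 0.
  rewrite -[RHS](ract0l W (e i)) -[X in ract X (e i)]relc !ract_suml.
  apply: eq_bigr => t At.
  rewrite !ractA -scalerAl socle_mul chi_idem.
  have [->|_] := eqVneq; first by rewrite mul1r mulr_algl scale1r.
  by rewrite !mul0r scale0r scaler0.
have ue : ract u (e i) = u.
  rewrite ract_suml; apply: eq_bigr => t At; rewrite ractA.
  have [<-|_] := eqVneq; last by rewrite !mul0r ract0r.
  by rewrite mul1r mulr_algl -mulr_algr -ractA v_idem.
have [d def_u] := ker_socle uf0.
have [q qE] : exists q : P -> T -> P,
    forall z, d z = \sum_(t in A) ract (v t) (q z t).
  exists (fun z => proj1_sig (constructive_indefinite_description _ (spanA (d z)))).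
  by move=> z; case: constructive_indefinite_description.
(* These are the coefficients of u = u e_i after expanding each [d z] over the generators. The
   factor e_i kills chi_j for j != i, and chi_i(z) = 0 because z != e_i. *)
pose y t := \sum_(z <- Om | z != e i) q z t * z * e i.
have y0 t j : chi j (y t) = 0.
  rewrite linear_sum big1_seq //= => z /andP[nez Omz].
  rewrite !chiM chi_idem; have [->|_] := eqVneq j i; last by rewrite mulr0.
  by rewrite (Om_chi _ Omz) (negPf nez) mulr0 mul0r.
have uy : u = \sum_(t in A) ract (v t) (y t).
  rewrite -{1}ue {1}def_u ract_suml; under [RHS]eq_bigr do rewrite ract_sumr.
  rewrite exchange_big; apply: eq_bigr => z _.
  by rewrite qE !ract_suml; apply: eq_bigr => t _; rewrite !ractA mulrA.
have [z cyz] := scalar_sub_right_inverse nzc (y0 t1).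
(* The two expressions of u are subtracted and multiplied by [z]; the coefficient of v_t1 becomes
   -1, so v_t1 can be solved for. *)
pose g t := (y t - (a t == i)%:R * (c t)%:A) * z.
have vt1 : v t1 = \sum_(t in A :\ t1) ract (v t) (g t).
  have : \sum_(t in A) ract (v t) (g t) = 0.
    under eq_bigr do rewrite -ractA ractBr.
    by rewrite -ract_suml sumrB -uy subrr ract0l.
  rewrite (big_setD1 t1) //= {1}/g eqxx mul1r -opprB mulNr cyz.
  rewrite -sub0r ractBr ract0r ract1 sub0r addrC => /eqP.
  by rewrite subr_eq0 => /eqP.
move=> w; have [s ->] := spanA w; exists (fun t => g t * s t1 + s t).
rewrite (big_setD1 t1) //= {1}vt1 ract_suml -big_split /=.
by apply: eq_bigr => t _; rewrite ractDr ractA.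
Qed.

(** Generators are discarded by [spans_exchange] until no nontrivial relation is left. A relation
    counts as trivial when all e_(a t) p_t vanish, since v_t = v_t e_(a t) sees only that part of
    p_t. *)
Lemma spans_independent (A : {set T}) : spans A ->
  exists2 B, spans B & forall p : T -> P,
    \sum_(t in B) ract (v t) (p t) = 0 -> forall t, t \in B -> e (a t) * p t = 0.
Proof.
have [k] := ubnP #|A|; elim: k A => // k IHk A leAk spanA.
case: (classic (exists (p : T -> P) t0, [/\ \sum_(t in A) ract (v t) (p t) = 0,
    t0 \in A & e (a t0) * p t0 != 0])) => [|noA].
  case=> p [t0 [rel0 At0 nzt0]].
  have [t1 At1] := spans_exchange spanA rel0 At0 nzt0.
  apply: IHk; rewrite -ltnS (leq_trans _ leAk) //.
  by rewrite [in X in (_ < X)%N](cardsD1 t1) At1.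
exists A => // p rel0 t At; case: (eqVneq (e (a t) * p t) 0) => // nzt.
by case: noA; exists p, t.
Qed.

End SpanOfGenerators.

(** Each generator is split as the sum of the g_j e_i. An independent spanning subfamily of these
    gives maps from the e_(a t)P to W, jointly onto by spanning and jointly injective by
    independence. *)
Lemma interlocked_direct_sum (W : rmodType P) :
  finitely_generated W -> interlocked W e f Om ->
  exists (r : nat) (a : 'I_r -> 'I_n)
    (iota : forall j, {linear principal (e (a j)) -> W}), direct_sum iota.
Proof.
case=> m [g gW] ilW.
pose v (t : 'I_m * 'I_n) : W := ract (g t.1) (e t.2).
have v_idem t : ract (v t) (e t.2) = v t by rewrite ractA idemK.
have spanT : spans v setT.
  move=> w; have [b ->] := gW w; exists (fun t => e t.2 * b t.1).
  under [RHS]eq_bigl do rewrite inE.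
  rewrite -(pair_big xpredT xpredT (fun j i => ract (v (j, i)) (e i * b j))) /=.
  apply: eq_bigr => j _.
  have bE : b j = \sum_i e i * b j by rewrite -mulr_suml sum_idem mul1r.
  rewrite -[LHS]/(ract (g j) (b j)) {1}bE ract_sumr; apply: eq_bigr => i _.
  by rewrite ractA mulrA idemK.
have [A spanA indA] := spans_independent (fun i w => (ilW i w).1) v_idem spanT.
pose w (j : 'I_#|A|) := v (enum_val j).
exists #|A|, (fun j => (enum_val j).2), (fun j => principal_map _ (w j)).
split=> [x|u].
  have [p ->] := spanA x; exists (fun j => principal_elt _ (p (enum_val j))).
  rewrite big_enum_val; apply: eq_bigr => t _ /=.
  by rewrite -ractA v_idem.
move=> u0 j.
(* The family [u] is transported from ordinals to [T]: the sum has one term for t in [A] and none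
   elsewhere. *)
pose p t := \sum_(l < #|A| | enum_val l == t) (principal_val (u l) : P).
have pE l : p (enum_val l) = principal_val (u l).
  rewrite /p (bigD1 l) //= big1 ?addr0 // => l' /andP[/eqP/enum_val_inj->].
  by rewrite eqxx.
have relp : \sum_(t in A) ract (v t) (p t) = 0.
  by rewrite big_enum_val -[RHS]u0; apply: eq_bigr => l _; rewrite pE.
have := indA p relp _ (enum_valP j).
by rewrite pE (idem_mul_principal (idemK _)) => uj0; apply: val_inj.
Qed.

(** With a dual basis, w f_i = 0 gives c_j(w) f_i = 0, hence chi_i(c_j(w)) = 0, and [expand_ker_chi]
    rewrites each c_j(w). The other inclusion is rho f_i = chi_i(rho) f_i = 0, valid in every
    module. *)
Lemma projective_interlocked (W : rmodType P) :
  finitely_generated W -> projective W -> interlocked W e f Om.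
Proof.
move=> fgW projW i w; split=> [wf0 | [c ->]]; last first.
  rewrite ract_suml big1_seq // => x /andP[nex Omx].
  by rewrite ractA mul_socle (Om_chi _ Omx) (negPf nex) scale0r ract0r.
have [m [g [c cE]]] := projective_dual_basis fgW projW.
have /fin_all_exists[d dE] j : exists d : P -> K,
    (c j w : P) = \sum_(x <- Om | x != e i) d x *: x.
  apply: expand_ker_chi; apply/eqP.
  have : (c j w : P) * f i = 0.
    by have := linear_ract (c j) w (f i); rewrite wf0 linear0 => /esym.
  by rewrite mul_socle => /eqP; rewrite scaler_eq0 (negPf (socle_neq0 i)) orbF.
exists (fun x => \sum_(j < m) ract (g j) (d j x)%:A).
under [RHS]eq_bigr do rewrite ract_suml.
rewrite exchange_big {1}(cE w); apply: eq_bigr => j _ /=.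
rewrite -[LHS]/(ract (g j) (c j w)) dE ract_sumr.
by apply: eq_bigr => x _; rewrite ractA mulr_algl.
Qed.

(** An expansion of s(w) in [W] is carried back to [V] by [h]. This serves for the summands of an
    arbitrary decomposition. *)
Lemma summand_interlocked (V W : rmodType P)
    (h : {linear W -> V}) (s : {linear V -> W}) :
  cancel s h -> interlocked W e f Om -> interlocked V e f Om.
Proof.
move=> sK ilW i w; split=> [wf0 | [c ->]]; last first.
  rewrite ract_suml big1_seq // => x /andP[nex Omx].
  by rewrite ractA mul_socle (Om_chi _ Omx) (negPf nex) scale0r ract0r.
have [|c cE] := (ilW i (s w)).1; first by rewrite -linear_ract wf0 linear0.
exists (h \o c); rewrite -[LHS]sK cE linear_sum.
by apply: eq_bigr => x _; rewrite linear_ract.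
Qed.

(** Since x f_i = chi_i(x) f_i, the space e_(a j)P f_i is the line of f_i when a j = i and zero
    otherwise. So the images of e_(a j) f_i with a j = i form a basis of W f_i. *)
Lemma direct_sum_has_dim (W : rmodType P) (r : nat) (a : 'I_r -> 'I_n)
    (iota : forall j, {linear principal (e (a j)) -> W}) i :
  direct_sum iota ->
  has_dim (@ract_image K P W (f i)) #|[set j | a j == i]|.
Proof.
move=> sumW; set A := [set j | _]; pose g j := iota j (principal_elt _ 1).
exists (fun l => ract (g (enum_val l)) (f i)).
have scalar_comm c : c%:A * f i = f i * c%:A by rewrite mulr_algl mulr_algr.
split=> [x | c c0 l].
  split=> [[w ->] | [c ->]]; last first.
    exists (\sum_l ract (g (enum_val l)) (c l)%:A).
    by rewrite ract_suml; apply: eq_bigr => l _; rewrite !ractA scalar_comm.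
  have [u ->] := sumW.1 w.
  exists (fun l => chi i (principal_val (u (enum_val l)))).
  rewrite -(big_enum_val (fun j => ract (ract (g j) (f i))
    (chi i (principal_val (u j)))%:A)) ract_suml [RHS]big_mkcond.
  apply: eq_bigr => j _; rewrite inE -linear_ract.
  have uf : principal_val (ract (u j : (principal (e (a j)) : rmodType P)) (f i))
      = chi i (principal_val (u j)) *: f i by exact: mul_socle.
  have [eqai|neqai] := eqVneq.
    rewrite -!linear_ract; congr (iota j _); apply: val_inj; apply: (etrans uf).
    have ef : e (a j) * f i = f i by rewrite eqai idem_mul_socle eqxx scale1r.
    rewrite -[RHS]/(e (a j) * 1 * f i * (chi i (principal_val (u j)))%:A).
    by rewrite mulr1 ef mulr_algr.
  rewrite -[RHS](linear0 (iota j)); congr (iota j _).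
  apply: val_inj; apply: (etrans uf).
  rewrite -(idem_mul_principal (idemK _)) chiM // chi_idem eq_sym (negPf neqai).
  by rewrite mul0r scale0r.
(* The coefficients are extended by zero to all of ['I_r], so that directness of the full sum
   applies. *)
pose k j := \sum_(l' < #|A| | enum_val l' == j) c l'.
have kE l' : k (enum_val l') = c l'.
  rewrite /k (bigD1 l') //= big1 ?addr0 // => l2 /andP[/eqP/enum_val_inj->].
  by rewrite eqxx.
pose u j : principal (e (a j)) :=
  principal_elt _ (if a j == i then k j *: f i else 0).
have u0 : \sum_(j < r) iota j (u j) = 0.
  rewrite -[RHS]c0.
  rewrite -(eq_bigr _ (fun l _ => congr1 (fun z => ract (ract _ _) z%:A) (kE l))).
  rewrite -(big_enum_val (fun j => ract (ract (g j) (f i)) (k j)%:A)).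
  rewrite [RHS]big_mkcond.
  apply: eq_bigr => j _; rewrite inE /u.
  have [eqai|neqai] := eqVneq; last first.
    rewrite -[RHS](linear0 (iota j)); congr (iota j _); apply: val_inj.
    by rewrite /= mulr0.
  rewrite -!linear_ract; congr (iota j _); apply: val_inj.
  rewrite -[RHS]/(e (a j) * 1 * f i * (k j)%:A).
  by rewrite -[LHS]/(e (a j) * (k j *: f i)) mulr1 mulr_algr scalerAr.
have := congr1 (@principal_val K P _) (sumW.2 u u0 (enum_val l)) => /=.
have /[!inE]/eqP eqai := enum_valP l.
rewrite eqai eqxx kE -scalerAr idem_mul_socle eqxx scale1r => /eqP.
by rewrite scaler_eq0 (negPf (socle_neq0 i)) orbF => /eqP.
Qed.

(** A multiple of x lies in the socle, hence on the line of f_i, and can be rescaled: every nonzero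
    submodule of e_iP contains f_i. *)
Lemma principal_essential i (x : (principal (e i) : rmodType P)) :
  x <> 0 -> exists2 b, principal_val (ract x b) = f i & ract x b <> 0.
Proof.
move=> nzx; have nzv : (principal_val x : P) != 0.
  by apply/eqP=> v0; apply: nzx; apply: val_inj.
have [b Sxb nzxb] := socle_essential hS nzv.
have [c xbE] := principal_socle (x := ract x b) Sxb.
have nzc : c != 0.
  apply: contraNneq nzxb => c0; rewrite -[_ * b]/(principal_val (ract x b) : P).
  by rewrite xbE c0 scale0r.
have xbcE : principal_val (ract x (b * c^-1%:A)) = f i.
  rewrite -[LHS]/((principal_val x : P) * (b * c^-1%:A)) mulrA.
  rewrite -[_ * b]/(principal_val (ract x b) : P) xbE mulr_algr scalerA.
  by rewrite mulVf // scale1r.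
exists (b * c^-1%:A) => // xb0; have /eqP := socle_neq0 i.
by case; rewrite -xbcE xb0.
Qed.

(** Two nonzero complementary summands would both contain f_i, although they meet in zero. *)
Lemma principal_indecomposable i :
  indecomposable_module (principal (e i) : rmodType P).
Proof.
split=> [p0 | A B [h [h' hK h'K]]].
  have := congr1 (@principal_val K P _) (p0 (principal_elt _ 1)) => /= e0.
  have := chi_idem i i; rewrite eqxx -[e i]mulr1 e0 linear0.
  by move/esym/eqP; rewrite oner_eq0.
have [p0 | nzA] := classic (zero_module A); [by left | right => y].
apply: NNPP => nzy; apply: nzA => x; apply: NNPP => nzx.
have inj_h := can_inj hK; have h0 : h' 0 = 0 by rewrite -[0](linear0 h) hK.
have [|b xb _] := principal_essential (x := h' (x, 0)).
  by rewrite -h0 => /(can_inj h'K)[].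
have [|c yc nzyc] := principal_essential (x := h' (0, y)).
  by rewrite -h0 => /(can_inj h'K)[].
have /(congr1 h) : ract (h' (x, 0)) b = ract (h' (0, y)) c.
  by apply: val_inj; apply: etrans xb (esym yc).
rewrite !linear_ract !h'K => -[_ yc0]; case: nzyc; apply: inj_h.
rewrite linear_ract h'K linear0; congr (_, _); first exact: ract0l.
by apply: etrans (esym yc0) _; exact: ract0l.
Qed.

End Interlocked.

End SocleCharacters.

(** * Values of the characters on the Miyamoto basis *)

Section OmegaCharacters.
Variables (K : fieldType) (P : falgType K) (n : nat) (e f : 'I_n -> P).
Variables (phi : {scalar P}) (J S : {vspace P}) (rho : 'I_n -> 'I_n -> nat -> P).
Hypothesis hf : dual_socle_basis phi S e f.
Hypothesis hrho : miyamoto_basis phi J S e f rho.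

Lemma miyamoto_idem_socle i : e i * f i * e i = f i.
Proof.
have [_ <-] := miyamoto_a hrho i; apply: (miyamoto_b hrho).
by rewrite /basis_range eqxx mem_iota /=.
Qed.

(* This is condition (c) for the first factor [f i = rho_(d_ii + 1)^(ii)]. *)
Lemma Omega_character i x :
  x \in Omega J S e rho -> socle_character f phi i x = (x == e i)%:R.
Proof.
move=> Omx; have [xei|nex] := eqVneq x (e i).
  by rewrite /socle_character xei hf.2 eqxx.
case/allpairsPdep: Omx nex => -[a b] [s [_ /= ab_s ->]] nex.
pose d := peirce_dim J S e; rewrite -/(d a b) in ab_s.
have f_range : (d i i).+1 \in basis_range J S e i i.
  by rewrite /basis_range eqxx mem_iota /=.
(* Condition (c) has index d_ab + 1 - t in its second factor, so t = d_ab + 1 - s is taken. Both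
   forms of [basis_range] are stable under this reflection. *)
have [s_le s_range] : (s <= (d a b).+1)%N /\
    ((d a b).+1 - s)%N \in basis_range J S e a b.
  move: ab_s; rewrite /basis_range -/(d a b); case: eqP => _; rewrite !mem_iota.
    by rewrite !add0n !ltnS leq_subr.
  rewrite !add1n !ltnS => /andP[s_gt0 s_le]; split; first exact: leqW.
  by rewrite subn_gt0 ltnS s_le leq_subLR -add1n leq_add2r.
have := miyamoto_c hrho f_range s_range.
rewrite -/(d a b) subKn // (miyamoto_a hrho i).2 -/(socle_character f phi i _) => ->.
case: (i =P b) (i =P a) nex {ab_s} s_le s_range => [<- [<-|//]|//].
(* For a = b = i the value is 1 only if d_ii + 1 - s = d_ii + 1, that is s = 0, which is the
   excluded element e_i. *)
case: s => [|s] nex s_le _; first by rewrite (miyamoto_a hrho i).1 eqxx in nex.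
rewrite (_ : (_ == _) = false) //; apply/eqP=> eq_d.
by have := leq_subr s (d i i); rewrite subSS in eq_d; rewrite -eq_d ltnn.
Qed.

End OmegaCharacters.

(** * Equivalence with projectivity, and multiplicities *)

Theorem theorem3p5 (K : closedFieldType) (charK : [pchar K] =i pred0)
    (P : falgType K) (n : nat) (e : 'I_n -> P)
    (he : complete_primitive_idempotents e)
    (P_basic : basic_algebra e)
    (P_symmetric : symmetric_algebra P)
    (P_indecomposable : indecomposable_algebra P)
    (phi : {scalar P})
    (phi_symmetric : symmetric_function phi)
    (phi_nondegenerate : nondegenerate_form phi)
    (phi_e : forall i, phi (e i) = 0)
    (J S : {vspace P}) (hJ : is_jacobson_radical J) (hS : is_socle S)
    (f : 'I_n -> P) (hf : dual_socle_basis phi S e f)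
    (rho : 'I_n -> 'I_n -> nat -> P)
    (hrho : miyamoto_basis phi J S e f rho)
    (W : rmodType P) (W_fg : finitely_generated W) :
  (interlocked W e f (Omega J S e rho) <-> projective W) /\
  (interlocked W e f (Omega J S e rho) ->
   forall i, exists m : nat,
     has_dim (@ract_image K P W (f i)) m /\
     multiplicity (principal (e i) : rmodType P) W m).
Proof.
have efe := miyamoto_idem_socle hrho.
have Om_basis := miyamoto_basis_of hrho.
have Om_chi := @Omega_character _ _ _ _ _ _ _ _ _ hf hrho.
have idem_e i : e i * e i = e i by exact: idemK.
have decomp (V : rmodType P) :
    finitely_generated V -> interlocked V e f (Omega J S e rho) ->
    exists (r : nat) (a : 'I_r -> 'I_n)
      (iota : forall j, {linear principal (e (a j)) -> V}), direct_sum iota.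
  exact: (interlocked_direct_sum he phi_symmetric phi_nondegenerate hS hf efe).
split.
  split=> [ilW | projW].
    have [r [a [iota sumW]]] := decomp W W_fg ilW.
    by apply: (direct_sum_projective sumW) => j; apply: principal_projective.
  exact: (projective_interlocked he phi_symmetric phi_nondegenerate hS hf efe).
move=> ilW i; have [r [a [iota sumW]]] := decomp W W_fg ilW.
exists #|[set j | a j == i]|; split.
  exact: (direct_sum_has_dim he phi_symmetric phi_nondegenerate hS hf efe i sumW).
split.
  exists r, (fun j => principal (e (a j)) : rmodType P); split; last by exists iota.
  by move=> j; apply: (principal_indecomposable he hS hf efe).
move=> q U [indecU [kappa sumU]].
have [pi [_ _ kappaK]] := direct_sum_proj sumU.
(* Every summand of an arbitrary decomposition is finitely generated and interlocked, hence itself a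
   sum of modules e_lP. *)
have /fin_all_exists[a' /= isoU] j :
    exists l : 'I_n, isomorphic (principal (e l) : rmodType P) (U j).
  have fgU : finitely_generated (U j).
    apply: (finitely_generated_onto (h := pi j)) => // y.
    by exists (kappa j y); apply: kappaK.
  have ilU := summand_interlocked he phi_symmetric phi_nondegenerate hS hf efe
    Om_chi (kappaK j) ilW.
  have [[|s] [b [lam sumUj]]] := decomp _ fgU ilU.
    (* An empty sum would make [U j] zero; otherwise its first term is a nonzero summand of an
       indecomposable module, hence all of it. *)
    case: (indecU j) => nzU _; case: nzU => x.
    by have [u ->] := sumUj.1 x; rewrite big_ord0.
  have [pi' [_ _ lamK]] := direct_sum_proj sumUj.
  exists (b ord0); apply: indecomposable_split_epi (lamK ord0) (indecU j) _.
  by case: (principal_indecomposable he hS hf efe (b ord0)).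
have /fin_all_exists[theta bij_theta] j :
    exists t : {linear (principal (e (a' j)) : rmodType P) -> U j}, bijective t.
  exact: isoU.
have sumW' := direct_sum_isomorphic sumU bij_theta.
exists [set j | a' j == i]; split=> [j|].
  rewrite inE; split=> [/eqP<- // | iso_ij]; apply/eqP; apply: P_basic.
  exact: isomorphic_trans (isoU j) (isomorphic_sym iso_ij).
(* Both decompositions compute the dimension of W f_i, so their counts of copies of e_iP agree. *)
have dimE := direct_sum_has_dim he phi_symmetric phi_nondegenerate hS hf efe i.
exact: has_dim_unique (dimE _ _ _ _ sumW') (dimE _ _ _ _ sumW).
Qed.
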